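(* Let $G$ be a (small) groupoid with finitely many objects and let $R=A\rtimes^{\sigma}G$ be a skew groupoid algebra, graded by $G$, whose principal component $A$ is commutative. Then $A$ is maximal commutative in $R$ (i.e. $C_R(A)=A$) if and only if $A$ has the ideal intersection property in $R$.
   Context: All rings are associative and unital with nonzero identity; ring homomorphisms preserve identities. For a subset $S$ of a ring $R$, $C_R(S)$ is the set of elements of $R$ commuting with every element of $S$. A subring $R'$ of $R$ has the ideal intersection property in $R$ if $R'\cap I\neq\{0\}$ for each nonzero two-sided ideal $I$ of $R$. A commutative subring $R'$ is maximal commutative in $R$ if $R'=C_R(R')$. Write $s\in G$ for a morphism $s$ of $G$, with domain $d(s)$ and codomain $c(s)$. Objects are identified with their identity morphisms. $G^{(2)}$ is the set of pairs $(s,t)$ of morphisms with $d(s)=c(t)$ (so that $st$ is defined). A groupoid is a category in which all morphisms are isomorphisms. Skew groupoid algebra: one is given rings $A_e$, $e\in \mathrm{ob}(G)$, with $A=\bigoplus_{e\in \mathrm{ob}(G)}A_e$, and ring homomorphisms $\sigma_s:A_{d(s)}\to A_{c(s)}$, $s\in G$, such that $\sigma_e=\mathrm{id}_{A_e}$ for all $e\in\mathrm{ob}(G)$ and $\sigma_s\sigma_t=\sigma_{st}$ for all $(s,t)\in G^{(2)}$. $A\rtimes^{\sigma}G$ is the set of formal sums $\sum_{s\in G}a_su_s$ with $a_s\in A_{c(s)}$, all but finitely many zero, with componentwise addition and with multiplication the bilinear extension of $(a_su_s)(b_tu_t)=a_s\sigma_s(b_t)u_{st}$ if $(s,t)\in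 G^{(2)}$, and $(a_su_s)(b_tu_t)=0$ otherwise, where $a_s\in A_{c(s)}$, $b_t\in A_{c(t)}$. It is graded by $G$ with $R_s=A_{c(s)}u_s$, and when $G$ has finitely many objects its identity is $\sum_{e\in\mathrm{ob}(G)}u_e$. Its principal component $\bigoplus_{e\in\mathrm{ob}(G)}A_eu_e$ is identified with $A$. *)

(* Defs.v *)
From HB Require Import structures.
From mathcomp Require Import all_boot all_order all_algebra.
From mathcomp Require Import finmap.
From mathcomp Require Import monalg.

Set Implicit Arguments.
Unset Strict Implicit.
Unset Printing Implicit Defensive.

Import GRing.Theory.
Local Open Scope ring_scope.

(* A small category with finitely many objects. A morphism s : hom e f has
   domain e and codomain f, so s and t are composable, with d(s) = c(t), exactly
   when s : hom f g and t : hom e f. *)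
Record category := Category {
  ob : finType;
  hom : ob -> ob -> choiceType;
  idm : forall e, hom e e;
  compm : forall e f g, hom f g -> hom e f -> hom e g;
  comp1m : forall e f (s : hom e f), compm (idm f) s = s;
  compm1 : forall e f (s : hom e f), compm s (idm e) = s;
  compA : forall e f g h (s : hom g h) (t : hom f g) (u : hom e f),
    compm s (compm t u) = compm (compm s t) u
}.
Arguments idm : clear implicits.
Arguments compm {c e f g} _ _.

Definition is_groupoid (C : category) : Prop :=
  forall (e f : ob C) (s : hom e f),
    exists t : hom f e, compm s t = idm C f /\ compm t s = idm C e.

Record skew_system (C : category) := SkewSystem {
  coef : ob C -> nzRingType;
  act : forall e f, hom e f -> {rmorphism coef e -> coef f};
  act_id : forall e a, act (idm C e) a = a;
  act_comp : forall e f g (s : hom f g) (t : hom e f) a,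
    act s (act t a) = act (compm s t) a
}.
Arguments act {C} _ {e f} _.

Section SkewAlgebra.
Variables (C : category) (D : skew_system C).

(* The formal sums of the a_s u_s with s : e -> f and a_s in A_f. *)
Definition homsum (e f : ob C) := {malg coef D f [hom e f]}.

(* As there are finitely many objects, a formal sum over all the morphisms is
   a family of formal sums, one over each hom(e, f). *)
Definition skewAlg := {dffun forall p : ob C * ob C, homsum p.1 p.2}.

HB.instance Definition _ := Choice.on skewAlg.

Implicit Types (x y z : skewAlg).

Definition skew0 : skewAlg := [ffun p => 0 : homsum p.1 p.2].
Definition skewN x : skewAlg := [ffun p => - x p : homsum p.1 p.2].
Definition skewD x y : skewAlg := [ffun p => x p + y p : homsum p.1 p.2].

Fact skewDA : associative skewD.
Proof. by move=> x y z; apply/ffunP=> p; rewrite !ffunE addrA. Qed.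

Fact skewDC : commutative skewD.
Proof. by move=> x y; apply/ffunP=> p; rewrite !ffunE addrC. Qed.

Fact skew0D : left_id skew0 skewD.
Proof. by move=> x; apply/ffunP=> p; rewrite !ffunE add0r. Qed.

Fact skewND : left_inverse skew0 skewN skewD.
Proof. by move=> x; apply/ffunP=> p; rewrite !ffunE addNr. Qed.

HB.instance Definition _ :=
  GRing.isZmodule.Build skewAlg skewDA skewDC skew0D skewND.

Lemma skew0E p : (0 : skewAlg) p = 0. Proof. by rewrite ffunE. Qed.
Lemma skewDE x y p : (x + y) p = x p + y p. Proof. by rewrite ffunE. Qed.
Lemma skew_sumE (I : Type) (r : seq I) (P : pred I) (F : I -> skewAlg) p :
  (\sum_(i <- r | P i) F i) p = \sum_(i <- r | P i) F i p.
Proof.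
by apply: (big_morph (fun x : skewAlg => x p)) => [x y|]; rewrite ?skewDE ?skew0E.
Qed.

(* The homogeneous element a u_s. *)
Definition mon (e f : ob C) (s : hom e f) (a : coef D f) : skewAlg :=
  finfun (dfwith (fun p : ob C * ob C => 0 : homsum p.1 p.2)
                 (i := (e, f)) << a *g s >>).

Definition hmul (e f g : ob C) (x : homsum f g) (y : homsum e f) : homsum e g :=
  \sum_(s <- msupp x) \sum_(t <- msupp y) << x@_s * act D s y@_t *g compm s t >>.

Definition skewM x y : skewAlg :=
  [ffun p => \sum_(f : ob C) @hmul p.1 f p.2 (x (f, p.2)) (y (p.1, f)) : homsum p.1 p.2].

Definition skew1 : skewAlg := \sum_(e : ob C) mon (idm C e) 1.

Lemma monE (e f : ob C) (s : hom e f) (a : coef D f) :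
  mon s a (e, f) = << a *g s >>.
Proof. by rewrite ffunE dfwith_in. Qed.

Lemma mon_out (e f : ob C) (s : hom e f) (a : coef D f) p :
  (e, f) != p -> mon s a p = 0.
Proof. by move=> ne; rewrite ffunE dfwith_out. Qed.

Lemma hmulw (e f g : ob C) (x : homsum f g) (y : homsum e f)
    (dx : {fset hom f g}) (dy : {fset hom e f}) :
  (msupp x `<=` dx)%fset -> (msupp y `<=` dy)%fset ->
  hmul x y = \sum_(s <- dx) \sum_(t <- dy) << x@_s * act D s y@_t *g compm s t >>.
Proof.
move=> lex ley; rewrite /hmul (big_fset_incl _ lex) /=.
  apply/eq_bigr=> k1 _; apply/big_fset_incl => // k _ /mcoeff_outdom ->.
  by rewrite rmorph0 mulr0 monalgU0.
move=> k _ /mcoeff_outdom xk.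
by rewrite big1 // => k' _; rewrite xk mul0r monalgU0.
Qed.

Lemma hmulDl (e f g : ob C) (x x' : homsum f g) (y : homsum e f) :
  hmul (x + x') y = hmul x y + hmul x' y.
Proof.
rewrite (hmulw (msuppD_le x x') (fsubset_refl _)).
rewrite (hmulw (fsubsetUl (msupp x) (msupp x')) (fsubset_refl _)).
rewrite (hmulw (fsubsetUr (msupp x) (msupp x')) (fsubset_refl _)).
rewrite -big_split /=; apply/eq_bigr=> s _.
rewrite -big_split /=; apply/eq_bigr=> t _.
by rewrite mcoeffD mulrDl monalgUD.
Qed.

Lemma hmulDr (e f g : ob C) (x : homsum f g) (y y' : homsum e f) :
  hmul x (y + y') = hmul x y + hmul x y'.
Proof.
rewrite (hmulw (fsubset_refl _) (msuppD_le y y')).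
rewrite (hmulw (fsubset_refl _) (fsubsetUl (msupp y) (msupp y'))).
rewrite (hmulw (fsubset_refl _) (fsubsetUr (msupp y) (msupp y'))).
rewrite -big_split /=; apply/eq_bigr=> s _.
rewrite -big_split /=; apply/eq_bigr=> t _.
by rewrite mcoeffD rmorphD mulrDr monalgUD.
Qed.

Lemma hmul0l (e f g : ob C) (y : homsum e f) : hmul (0 : homsum f g) y = 0.
Proof. by rewrite /hmul msupp0 big_seq_fset0. Qed.

Lemma hmul0r (e f g : ob C) (x : homsum f g) : hmul x (0 : homsum e f) = 0.
Proof. by rewrite /hmul big1 // => s _; rewrite msupp0 big_seq_fset0. Qed.

Lemma hmul_suml (e f g : ob C) (I : Type) (r : seq I) (P : pred I)
    (F : I -> homsum f g) (y : homsum e f) :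
  hmul (\sum_(i <- r | P i) F i) y = \sum_(i <- r | P i) hmul (F i) y.
Proof.
exact: (big_morph _ (fun v w => hmulDl v w y) (hmul0l g y)).
Qed.

Lemma hmul_sumr (e f g : ob C) (I : Type) (r : seq I) (P : pred I)
    (x : homsum f g) (F : I -> homsum e f) :
  hmul x (\sum_(i <- r | P i) F i) = \sum_(i <- r | P i) hmul x (F i).
Proof.
exact: (big_morph _ (hmulDr x) (hmul0r e x)).
Qed.

Lemma hmulUU (e f g : ob C) (s : hom f g) (t : hom e f)
    (a : coef D g) (b : coef D f) :
  hmul << a *g s >> << b *g t >> = << a * act D s b *g compm s t >>.
Proof. by rewrite (hmulw msuppU_le msuppU_le) !big_seq_fset1 !mcoeffUU. Qed.

Lemma hmulA (e f g h : ob C) (x : homsum g h) (y : homsum f g)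
    (z : homsum e f) :
  hmul x (hmul y z) = hmul (hmul x y) z.
Proof.
rewrite [x]monalgE !hmul_suml; apply/eq_bigr=> s _.
rewrite [y]monalgE !(hmul_suml, hmul_sumr); apply/eq_bigr=> t _.
rewrite [z]monalgE !(hmul_suml, hmul_sumr); apply/eq_bigr=> u _.
by rewrite !hmulUU rmorphM act_comp mulrA compA.
Qed.

Lemma hmul1l (e f : ob C) (x : homsum e f) : hmul << 1 *g idm C f >> x = x.
Proof.
rewrite [in LHS](monalgE x) hmul_sumr [in RHS](monalgE x).
by apply/eq_bigr=> s _; rewrite hmulUU act_id mul1r comp1m.
Qed.

Lemma hmul1r (e f : ob C) (x : homsum e f) : hmul x << 1 *g idm C e >> = x.
Proof.
rewrite [in LHS](monalgE x) hmul_suml [in RHS](monalgE x).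
by apply/eq_bigr=> s _; rewrite hmulUU rmorph1 mulr1 compm1.
Qed.

Lemma skew1E e : skew1 (e, e) = << 1 *g idm C e >>.
Proof.
rewrite skew_sumE (bigD1 e) //= monE big1 ?addr0 // => f nfe.
by rewrite mon_out // xpair_eqE negb_and nfe.
Qed.

Lemma skew1_out p : p.1 != p.2 -> skew1 p = 0.
Proof.
move=> ne; rewrite skew_sumE big1 // => e _; rewrite mon_out //.
by apply: contra ne => /eqP <-.
Qed.

Fact skewMA : associative skewM.
Proof.
move=> x y z; apply/ffunP=> -[e h]; rewrite !ffunE /=.
under eq_bigr => f _ do rewrite ffunE hmul_sumr.
rewrite exchange_big /=; apply/eq_bigr=> f _.
by rewrite ffunE hmul_suml; apply/eq_bigr=> g _; rewrite hmulA.
Qed.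

Fact skew1M : left_id skew1 skewM.
Proof.
move=> x; apply/ffunP=> -[e f]; rewrite ffunE /= (bigD1 f) //= skew1E hmul1l.
by rewrite big1 ?addr0 // => g ne; rewrite skew1_out // hmul0l.
Qed.

Fact skewM1 : right_id skew1 skewM.
Proof.
move=> x; apply/ffunP=> -[e f]; rewrite ffunE /= (bigD1 e) //= skew1E hmul1r.
by rewrite big1 ?addr0 // => g ne; rewrite skew1_out ?hmul0r //= eq_sym.
Qed.

Fact skewMDl : left_distributive skewM +%R.
Proof.
move=> x y z; apply/ffunP=> p; rewrite skewDE !ffunE -big_split /=.
by apply/eq_bigr=> f _; rewrite ffunE hmulDl.
Qed.

Fact skewMDr : right_distributive skewM +%R.
Proof.
move=> x y z; apply/ffunP=> p; rewrite skewDE !ffunE -big_split /=.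
by apply/eq_bigr=> f _; rewrite ffunE hmulDr.
Qed.

(* This is the zero ring when there is no object. *)
HB.instance Definition _ :=
  GRing.Zmodule_isPzRing.Build skewAlg skewMA skew1M skewM1 skewMDl skewMDr.

Lemma skewME x y p : (x * y) p = \sum_(f : ob C) @hmul p.1 f p.2 (x (f, p.2)) (y (p.1, f)).
Proof. by rewrite ffunE. Qed.

Lemma mon_mul (e f g : ob C) (s : hom f g) (t : hom e f)
    (a : coef D g) (b : coef D f) :
  mon s a * mon t b = mon (compm s t) (a * act D s b).
Proof.
apply/ffunP=> -[e' g']; rewrite skewME /=.
have [/eqP[<- <-]|ne] := boolP ((e, g) == (e', g')).
  rewrite (bigD1 f) //= !monE hmulUU big1 ?addr0 // => f' nf.
  by rewrite mon_out ?hmul0l // xpair_eqE eq_sym negb_and nf.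
rewrite mon_out // big1 // => f' _; move: ne.
rewrite xpair_eqE negb_and => /orP[ne|ng].
  by rewrite (mon_out t) ?hmul0r // xpair_eqE negb_and ne.
by rewrite (mon_out s) ?hmul0l // xpair_eqE negb_and ng orbT.
Qed.

Lemma mon_mul0 (e f f' g : ob C) (s : hom f g) (t : hom e f')
    (a : coef D g) (b : coef D f') :
  f != f' -> mon s a * mon t b = 0.
Proof.
move=> ne; apply/ffunP=> p; rewrite skewME skew0E big1 // => h _.
have [eh|nh] := eqVneq f h; last first.
  by rewrite (mon_out s) ?hmul0l // xpair_eqE negb_and nh.
by rewrite (mon_out t) ?hmul0r // xpair_eqE negb_and -eh (eq_sym f') ne orbT.
Qed.

Lemma monD (e f : ob C) (s : hom e f) : {morph @mon e f s : a b / a + b}.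
Proof.
move=> a b; apply/ffunP=> p; rewrite skewDE.
have [<-|ne] := eqVneq (e, f) p; first by rewrite !monE monalgUD.
by rewrite !mon_out ?addr0.
Qed.

Lemma mon_sum x :
  x = \sum_(e : ob C) \sum_(f : ob C)
        \sum_(s <- msupp (x (e, f))) mon s (x (e, f))@_s.
Proof.
apply/ffunP=> -[e f]; rewrite skew_sumE (bigD1 e) //= skew_sumE (bigD1 f) //=.
rewrite skew_sumE [LHS]monalgE [X in _ = _ + X + _]big1 => [|f' nf]; last first.
  rewrite skew_sumE big1 // => s _; rewrite mon_out //.
  by rewrite xpair_eqE negb_and nf orbT.
rewrite addr0 [X in _ = _ + X]big1 => [|e' ne]; last first.
  rewrite skew_sumE big1 // => f' _; rewrite skew_sumE big1 // => s _.
  by rewrite mon_out // xpair_eqE negb_and ne.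
by rewrite addr0; apply/eq_bigr=> s _; rewrite monE.
Qed.

(* The copy of A inside the algebra: the sums of the a_e u_e over objects e. *)
Definition principal (x : skewAlg) : Prop :=
  exists a : forall e : ob C, coef D e, x = \sum_(e : ob C) mon (idm C e) (a e).

End SkewAlgebra.

Section RingNotions.
Variable R : pzRingType.

Definition commutative_subset (S : R -> Prop) : Prop :=
  forall x y, S x -> S y -> x * y = y * x.

Definition centralizer (S : R -> Prop) (x : R) : Prop :=
  forall y, S y -> x * y = y * x.

Definition maximal_commutative (S : R -> Prop) : Prop :=
  forall x, S x <-> centralizer S x.

(* Ideals are Prop-valued predicates, so as not to restrict to decidable ones. *)
Definition two_sided_ideal (I : R -> Prop) : Prop :=
  [/\ I 0, forall x y, I x -> I y -> I (x - y)
    & forall r x, I x -> I (r * x) /\ I (x * r)].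

Definition ideal_intersection_property (S : R -> Prop) : Prop :=
  forall I : R -> Prop, two_sided_ideal I ->
    (exists x, I x /\ x <> 0) -> exists x, [/\ S x, I x & x <> 0].

End RingNotions.

(* Main.v *)
(* If A is maximal commutative, take a nonzero x in an ideal I.  Restricting to
   one hom-set and translating by the inverse of a morphism in the support of x
   yields y in I, of no larger support, with nonzero coefficient at an identity.
   For a in A the commutator y a - a y lies in I and has lost that coefficient,
   so when the support is minimal y centralizes A, and hence lies in A.

   Conversely, if an element centralizing A is not in A, then some nonidentity
   endomorphism s of an object e and some nonzero r in A_e satisfy
   r sigma_s(b) = b r for all b in A_e.  Let T send a formal sum to the sums of
   its coefficients over each hom-set: T is injective on A, while it vanishes on
   the ideal generated by r u_e - r u_s, which therefore meets A trivially. *)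

Require Import Defs.
From mathcomp Require Import all_boot all_algebra.
From mathcomp Require Import finmap monalg.
From Stdlib Require Import Classical.
Import Defs.

Set Implicit Arguments.
Unset Strict Implicit.
Unset Printing Implicit Defensive.

Import GRing.Theory.
Local Open Scope ring_scope.

(** * Supports of formal sums *)

Lemma sum_msupp_delta (K : choiceType) (V : zmodType) (W : nmodType)
    (h : {malg V[K]}) (F : K -> W) (k : K) :
  (k \notin msupp h -> F k = 0) ->
  \sum_(s <- msupp h) F s *+ (s == k) = F k.
Proof.
have [kh _|kh /(_ isT) ->] := boolP (k \in msupp h).
  rewrite (bigD1_seq k) ?fset_uniq //= eqxx big1 ?addr0 // => s /negPf ->.
  by [].
rewrite big1_seq // => s /andP[_ sh].
by case: eqVneq sh kh => // -> ->.
Qed.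

(* [monalg.msupp_eq0] requires the exponents to form a monoid. *)
Lemma msupp_neq0 (K : choiceType) (V : zmodType) (h : {malg V[K]}) :
  h != 0 -> msupp h != fset0.
Proof.
apply: contra => /eqP h0; apply/eqP/malgP => k.
by rewrite mcoeff0 mcoeff_outdom // h0.
Qed.

Section SkewAlgebraTheory.
Variables (C : category) (D : skew_system C).
Implicit Types (x y z : skewAlg D) (e f g : ob C).

(** * Coefficients of products with homogeneous elements *)

Lemma skewBE x y p : (x - y) p = x p - y p.
Proof. by apply: (addIr (y p)); rewrite -skewDE !subrK. Qed.

Lemma mon_mulE e f g (s : hom f g) (a : coef D g) x :
  (mon s a * x) (e, g) = hmul << a *g s >> (x (e, f)).
Proof.
rewrite skewME /= (bigD1 f) //= monE big1 ?addr0 // => h nh.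
by rewrite mon_out ?hmul0l // xpair_eqE eq_sym (negPf nh).
Qed.

Lemma mon_mulE0 f g (s : hom f g) (a : coef D g) x p :
  g != p.2 -> (mon s a * x) p = 0.
Proof.
move=> ne; rewrite skewME big1 // => h _.
by rewrite mon_out ?hmul0l // xpair_eqE (negPf ne) andbF.
Qed.

Lemma mul_monE e f g (t : hom e f) (b : coef D f) x :
  (x * mon t b) (e, g) = hmul (x (f, g)) << b *g t >>.
Proof.
rewrite skewME /= (bigD1 f) //= monE big1 ?addr0 // => h nh.
by rewrite mon_out ?hmul0r // xpair_eqE [f == h]eq_sym (negPf nh) andbF.
Qed.

Lemma mul_monE0 e f (t : hom e f) (b : coef D f) x p :
  e != p.1 -> (x * mon t b) p = 0.
Proof.
move=> ne; rewrite skewME big1 // => h _.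
by rewrite mon_out ?hmul0r // xpair_eqE (negPf ne).
Qed.

(** Since [t] is invertible with inverse [t'], the only [s] with [compm s t = k] is [compm k t'], so
    a single term contributes. *)
Lemma mcoeff_hmul_iso e f g (t : hom e f) (t' : hom f e)
    (h : homsum D f g) (b : coef D f) (k : hom e g) :
  compm t t' = idm C f -> compm t' t = idm C e ->
  (hmul h << b *g t >>)@_k = h@_(compm k t') * act D (compm k t') b.
Proof.
move=> tt' t't; rewrite [in LHS](monalgE h) hmul_suml raddf_sum /=.
rewrite -(@sum_msupp_delta _ _ _ h (fun s => h@_s * act D s b)); last first.
  by move=> /mcoeff_outdom ->; rewrite mul0r.
apply: eq_bigr => s _; rewrite hmulUU mcoeffU; congr (_ *+ (nat_of_bool _)).
by apply/eqP/eqP => [<-|->]; rewrite -compA ?tt' ?t't compm1.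
Qed.

Lemma mcoeff_hmul_id e f (h : homsum D e f) (b : coef D e) (k : hom e f) :
  (hmul h << b *g idm C e >>)@_k = h@_k * act D k b.
Proof. by rewrite (@mcoeff_hmul_iso _ _ _ _ (idm C e)) ?compm1. Qed.

Lemma mcoeff_id_hmul e f (h : homsum D e f) (a : coef D f) (k : hom e f) :
  (hmul << a *g idm C f >> h)@_k = a * h@_k.
Proof.
rewrite [in LHS](monalgE h) hmul_sumr raddf_sum /=.
rewrite -(@sum_msupp_delta _ _ _ h (fun s => a * h@_s)); last first.
  by move=> /mcoeff_outdom ->; rewrite mulr0.
by apply: eq_bigr => s _; rewrite hmulUU mcoeffU comp1m act_id.
Qed.

Lemma mon0 e f (s : hom e f) : mon s 0 = 0 :> skewAlg D.
Proof. by apply: (addrI (mon s 0)); rewrite -monD !addr0. Qed.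

Lemma skew_mon_ind (P : skewAlg D -> Prop) :
  P 0 -> (forall x y, P x -> P y -> P (x + y)) ->
  (forall e f (s : hom e f) a, P (mon s a)) -> forall x, P x.
Proof.
move=> P0 PD Pm x; rewrite (mon_sum x).
by do 3 (elim/big_ind: _ => // ? _).
Qed.

(** * The principal component and its centralizer *)

Definition diag (a : forall e, coef D e) : skewAlg D :=
  \sum_(e : ob C) mon (idm C e) (a e).

Lemma diagE a e : diag a (e, e) = << a e *g idm C e >>.
Proof.
rewrite skew_sumE (bigD1 e) //= monE big1 ?addr0 // => f nfe.
by rewrite mon_out // xpair_eqE (negPf nfe).
Qed.

Lemma diag_out a p : p.1 != p.2 -> diag a p = 0.
Proof.
move=> ne; rewrite skew_sumE big1 // => e _; rewrite mon_out //.
by apply: contra ne => /eqP <-.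
Qed.

Lemma principal_diag a : principal (diag a).
Proof. by exists a. Qed.

Lemma principalE x :
  (forall p, p.1 != p.2 -> x p = 0) ->
  (forall e s, s != idm C e -> (x (e, e))@_s = 0) -> principal x.
Proof.
move=> x_out x_id; exists (fun e => (x (e, e))@_(idm C e)).
rewrite -/(diag _); apply/ffunP => -[e f].
have [<-|ne] := eqVneq e f; last by rewrite x_out // diag_out.
rewrite diagE; apply/malgP => s; rewrite mcoeffU eq_sym.
by have [->|/x_id ->] := eqVneq s.
Qed.

Lemma mcoeff_diag_mul a x p k : ((diag a * x) p)@_k = a p.2 * (x p)@_k.
Proof.
case: p k => e f /= k.
rewrite skewME /= (bigD1 f) //= diagE big1 ?addr0 => [|h nh].
  exact: mcoeff_id_hmul.
by rewrite diag_out ?hmul0l.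
Qed.

Lemma mcoeff_mul_diag a x p k :
  ((x * diag a) p)@_k = (x p)@_k * act D k (a p.1).
Proof.
case: p k => e f /= k.
rewrite skewME /= (bigD1 e) //= diagE big1 ?addr0 => [|h nh].
  exact: mcoeff_hmul_id.
by rewrite diag_out ?hmul0r //= eq_sym.
Qed.

(** Multiplication by [diag a] on either side acts on each coefficient separately, so commutation
    can be tested coefficientwise. *)
Lemma centralizer_principal x :
  (forall (a : forall e, coef D e) p k, (x p)@_k * act D k (a p.1) = a p.2 * (x p)@_k) <->
  centralizer (@principal C D) x.
Proof.
split=> [xC _ [a ->]|xC a p k].
  rewrite -/(diag a); apply/ffunP => p; apply/malgP => k.
  by rewrite mcoeff_mul_diag mcoeff_diag_mul xC.
by rewrite -mcoeff_mul_diag -mcoeff_diag_mul xC //; apply: principal_diag.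
Qed.

Lemma principal_mon_id e a : principal (mon (idm C e) a : skewAlg D).
Proof.
exists (@dfwith _ (coef D) (fun _ => 0) e a); rewrite (bigD1 e) //= dfwith_in.
rewrite big1 ?addr0 // => f nf.
by rewrite dfwith_out 1?eq_sym // mon0.
Qed.

Lemma coef_commutative :
  commutative_subset (@principal C D) -> forall e (a b : coef D e), a * b = b * a.
Proof.
move=> commA e a b.
have /ffunP/(_ (e, e))/malgP/(_ (idm C e)) :=
  commA _ _ (principal_mon_id a) (principal_mon_id b).
by rewrite !mon_mul !monE !act_id comp1m !mcoeffUU.
Qed.

(* Multiplying on the left by [u_f] and on the right by [u_t^-1], where [t] has
   codomain [f]. *)
Lemma translate_to_identity e f (t : hom e f) x :
  is_groupoid C -> (x (e, f))@_t != 0 ->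
  exists r1 r2 : skewAlg D, let y := r1 * x * r2 in
  [/\ forall p, p != (f, f) -> y p = 0,
      (y (f, f))@_(idm C f) != 0
    & (#|` msupp (y (f, f))| <= #|` msupp (x (e, f))|)%N].
Proof.
move=> /(_ _ _ t)[t' [tt' t't]] xt.
exists (mon (idm C f) 1), (mon t' 1) => /=; set y := _ * _ * _.
have yE k : (y (f, f))@_k = (x (e, f))@_(compm k t).
  by rewrite mul_monE mon_mulE hmul1l (mcoeff_hmul_iso _ _ _ t't tt') rmorph1 mulr1.
split.
- case=> g h; rewrite xpair_eqE negb_and => /orP[ng|nh].
    by rewrite mul_monE0 //= eq_sym.
  by rewrite /y -mulrA mon_mulE0 //= eq_sym.
- by rewrite yE comp1m.
(* Right translation by [t] embeds the support of [y] into that of [x (e, f)]. *)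
have inj : injective (fun k : hom f f => compm k t).
  by move=> k k' /(congr1 (fun s => compm s t')); rewrite -!compA tt' !compm1.
rewrite -(card_imfset imfset_key (mem (msupp (y (f, f)))) inj) fsubset_leq_card //.
apply/fsubsetP => _ /imfsetP[k /= ky ->].
by rewrite -mcoeff_neq0 -yE mcoeff_neq0.
Qed.

(** * Sums of coefficients and the ideal on which they vanish *)

(** This is the map T: sending every morphism to 1 leaves the sum of the coefficients. *)
Definition aug x (p : ob C * ob C) : coef D p.2 :=
  mmap idfun (fun _ => 1) (x p).

Lemma aug0 p : aug 0 p = 0.
Proof. by rewrite /aug skew0E raddf0. Qed.

Lemma augD x y p : aug (x + y) p = aug x p + aug y p.
Proof. by rewrite /aug skewDE raddfD. Qed.

Lemma augB x y p : aug (x - y) p = aug x p - aug y p.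
Proof. by rewrite /aug skewBE raddfB. Qed.

Lemma aug_mon_eq e f (s t : hom e f) (a : coef D f) p :
  aug (mon s a) p = aug (mon t a) p.
Proof.
rewrite /aug; have [<-|ne] := eqVneq (e, f) p; last by rewrite !mon_out.
by rewrite !monE !mmapU.
Qed.

Lemma aug_diag a e : aug (diag a) (e, e) = a e.
Proof. by rewrite /aug diagE mmapU mulr1. Qed.

(** The largest two-sided ideal inside the kernel of [aug]. The kernel itself need not be stable
    under right multiplication, because of the twist by the action. *)
Definition aug_ideal x : Prop := forall y z p, aug (y * x * z) p = 0.

Lemma aug_ideal_two_sided : two_sided_ideal aug_ideal.
Proof.
split=> [y z p|x x' Ix Ix' y z p|r x Ix].
- by rewrite mulr0 mul0r aug0.
- by rewrite mulrBr mulrBl augB Ix Ix' subr0.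
- by split=> y z p; rewrite ?mulrA -?(mulrA _ r z).
Qed.

Lemma aug_ideal_principal x : principal x -> aug_ideal x -> x = 0.
Proof.
move=> [a ->] Ix; rewrite big1 // => e _.
by rewrite -(aug_diag a e) -[diag a]mul1r -[_ * _]mulr1 Ix mon0.
Qed.

(** For homogeneous [y] and [z], the factor [r] absorbs the twist by [s], so the two terms of the
    product carry the same coefficient on parallel morphisms and cancel under [aug]. *)
Lemma mon_diff_aug_ideal e (s : hom e e) (r : coef D e) :
  (forall b, r * act D s b = r * b) ->
  aug_ideal (mon (idm C e) r - mon s r).
Proof.
move=> rs y z p; move: y.
apply: skew_mon_ind => [|y y' IHy IHy'|f g t a].
- by rewrite !mul0r aug0.
- by rewrite !mulrDl augD IHy IHy' addr0.
move: z; apply: skew_mon_ind => [|z z' IHz IHz'|d f' u b].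
- by rewrite mulr0 aug0.
- by rewrite mulrDr augD IHz IHz' addr0.
have [fe|ne] := eqVneq f e; last by rewrite mulrBr !mon_mul0 // subr0 mul0r aug0.
have [ef'|ne] := eqVneq e f'; last by rewrite -mulrA mulrBl !mon_mul0 // subr0 mulr0 aug0.
case: e / fe ef' s r rs => ef'; case: f' / ef' u b => u b s r rs.
rewrite -mulrA mulrBl mulrBr !mon_mul act_id rs augB comp1m.
by rewrite (aug_mon_eq _ (compm t u)) subrr.
Qed.

(** * The two implications *)

Lemma maximal_intersection :
  is_groupoid C -> commutative_subset (@principal C D) ->
  maximal_commutative (@principal C D) ->
  ideal_intersection_property (@principal C D).
Proof.
move=> gC commA maxA I [I0 IB IM] [x [Ix x0]].
(* The induction bounds the support in one hom-set only; [x] may be nonzero on others, as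
   translation discards them. *)
suff IH n : forall x p, I x -> x p != 0 -> (#|` msupp (x p)| <= n)%N ->
    exists y, [/\ principal y, I y & y <> 0].
  have [p xp] : exists p, x p != 0.
    apply: NNPP => nx; apply: x0; apply/ffunP => p; rewrite skew0E.
    by apply/eqP/negPn/negP => xp; apply: nx; exists p.
  exact: (IH _ x p).
elim: n => [|n IHn] {Ix x0}x [e f] Ix.
  by move=> xp; rewrite leqn0 cardfs_eq0 (negPf (msupp_neq0 xp)).
move=> /msupp_neq0/fset0Pn[t]; rewrite -mcoeff_neq0 => xt szx.
have [r1 [r2 [y_out y_id szy]]] := translate_to_identity gC xt.
set y := r1 * x * r2 in y_out y_id szy.
have Iy : I y by apply: (IM r2 _ _).2; apply: (IM r1 _ _).1.
have [yC|] := classic (centralizer (@principal C D) y).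
  exists y; split=> //; first exact/maxA.
  by move=> y0; rewrite y0 skew0E mcoeff0 eqxx in y_id.
(* If [I] had no nonzero element of A, the induction hypothesis would force every commutator [z] to
   vanish. *)
move=> ynC; apply: NNPP => nex; apply: ynC => _ [a ->]; rewrite -/(diag a).
apply/eqP; rewrite -subr_eq0; apply/eqP; set z := _ - _.
have zE p k : (z p)@_k = (y p)@_k * act D k (a p.1) - a p.2 * (y p)@_k.
  by rewrite skewBE mcoeffB mcoeff_mul_diag mcoeff_diag_mul.
have Iz : I z by apply: IB; [apply: (IM _ _ _).2|apply: (IM _ _ _).1].
have zf : z (f, f) = 0.
  apply/eqP/negPn/negP => zf; apply: nex; apply: (IHn z (f, f)) => //.
  rewrite -ltnS (leq_trans _ szx) // (leq_trans _ szy) // fproper_ltn_card //.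
  (* Commutativity of A removes the identity from the support, and no new morphism enters. *)
  apply: (@fsub_proper_trans _ (msupp (y (f, f)) `\ idm C f)%fset).
    apply/fsubsetP => k; rewrite in_fsetD1 -!mcoeff_neq0 zE /= => zk.
    apply/andP; split; apply: contra zk => /eqP ->.
      by rewrite act_id (coef_commutative commA) subrr.
    by rewrite mul0r mulr0 subrr.
  by apply: fproperD1; rewrite -mcoeff_neq0.
apply/ffunP => p; rewrite skew0E; have [->//|np] := eqVneq p (f, f).
by apply/malgP => k; rewrite zE y_out // mcoeff0 mul0r mulr0 subrr.
Qed.

Lemma intersection_maximal :
  commutative_subset (@principal C D) ->
  ideal_intersection_property (@principal C D) ->
  maximal_commutative (@principal C D).
Proof.
move=> commA intA x; split=> [Ax y Ay|/centralizer_principal xC]; first exact: commA.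
apply: principalE => [[e f] /= ne|e s ns].
  apply/malgP => k.
  (* Commuting with [u_f] kills this coefficient: the chosen family is 1 at [f] and 0 at [e]. *)
  have := xC (@dfwith _ (coef D) (fun _ => 0) f 1) (e, f) k.
  by rewrite /= dfwith_in dfwith_out 1?eq_sym // rmorph0 mulr0 mul1r mcoeff0.
apply/eqP/negPn/negP => r0; set r := (x (e, e))@_s in r0.
have rs b : r * act D s b = r * b.
  have := xC (@dfwith _ (coef D) (fun _ => 0) e b) (e, e) s.
  by rewrite /= dfwith_in => ->; apply: coef_commutative.
have [|y [Ay Iy]] := intA _ aug_ideal_two_sided.
  exists (mon (idm C e) r - mon s r); split; first exact: mon_diff_aug_ideal.
  (* As [s] is not the identity, comparing coefficients at the identity would give [r = 0]. *)
  move=> /eqP; rewrite subr_eq0 => /eqP/ffunP/(_ (e, e)).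
  rewrite !monE => /malgP/(_ (idm C e)); rewrite mcoeffUU mcoeffU (negPf ns) => /eqP.
  exact/negP.
by case; apply: aug_ideal_principal.
Qed.

End SkewAlgebraTheory.

Theorem theorem5 (G : category) (D : skew_system G)
  (G_groupoid : is_groupoid G)
  (A_commutative : commutative_subset (@principal G D)) :
  maximal_commutative (@principal G D) <->
  ideal_intersection_property (@principal G D).
Proof.
split; first exact: maximal_intersection.
exact: intersection_maximal.
Qed.
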